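(* Let $P=K[X]$ be endowed with $\sigma$, a monomial ordering and a weight function $\mathrm{w}$ as in the context. Let $I\subset P$ be a $\mathrm{w}$-graded $\Sigma$-invariant ideal and fix $d\ge0$. Assume that $I$ has a $\mathrm{w}$-homogeneous $\Sigma$-basis $H$ such that $H_d=\{f\in H\mid\mathrm{w}(f)\le d\}$ is a finite set. Then there is a $\mathrm{w}$-homogeneous Gröbner $\Sigma$-basis $G$ of $I$ such that $G_d=\{f\in G\mid\mathrm{w}(f)\le d\}$ is also a finite set. In other words, with a selection strategy for the S-polynomials based on their weights, the $d$-truncated version of the algorithm SigmaGBasis stops in a finite number of steps.
   Context: $K$ is a field, $X=\{x_0,x_1,\ldots\}$ a countable set of variables, $P=K[X]$ the commutative polynomial ring, $\mathrm{Mon}(P)$ its set of monomials (including 1). $\sigma:P\to P$ is an injective $K$-algebra endomorphism of infinite order mapping monomials to monomials, with $\gcd(\sigma(x_i),\sigma(x_j))=1$ for $i\neq j$. $P$ is endowed with a monomial ordering $\prec$ (total well-ordering of $\mathrm{Mon}(P)$ compatible with multiplication) such that $m\prec n$ implies $\sigma(m)\prec\sigma(n)$. $\Sigma=\{s^i\}_{i\ge0}$ acts on $P$ by $s^i\cdot f=\sigma^i(f)$; an ideal $I$ is $\Sigma$-invariant if $\sigma(I)\subset I$. $H\subset I$ is a $\Sigma$-basis of $I$ if $\Sigma\cdot H=\{\sigma^i(f)\mid f\in H,i\ge0\}$ generates $I$ as an ideal of $P$; it is a Gröbner $\Sigma$-basis if $\Sigma\cdot H$ is a Gröbner basis of $I$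 (i.e. the leading monomials of nonzero elements of $\Sigma\cdot H$ generate the ideal generated by all leading monomials of nonzero elements of $I$). Bases are taken to consist of nonzero elements. $\mathrm{lm}(f),\mathrm{lc}(f)$ denote leading monomial and leading coefficient. Weights: $\hat{\mathbb{N}}=\{-\infty\}\cup\mathbb{N}$, with $\max(-\infty,x)=x$ and $-\infty+x=-\infty$. A weight function is a map $\mathrm{w}:\mathrm{Mon}(P)\to\hat{\mathbb{N}}$ with $\mathrm{w}(1)=-\infty$, $\mathrm{w}(x_i)\in\mathbb{N}$ for every variable, $\mathrm{w}(mn)=\max(\mathrm{w}(m),\mathrm{w}(n))$, $\mathrm{w}(\sigma(x_i))=1+\mathrm{w}(x_i)$. $P_i$ is the $K$-span of the monomials of weight $i$; nonzero $f\in P_i$ is $\mathrm{w}$-homogeneous with $\mathrm{w}(f)=i$. $I$ is $\mathrm{w}$-graded if $I=\sum_i(I\cap P_i)$. A set is $\mathrm{w}$-homogeneous if all its elements are. $\mathrm{spoly}(f,g)=\frac{l}{\mathrm{lc}(f)\mathrm{lm}(f)}f-\frac{l}{\mathrm{lc}(g)\mathrm{lm}(g)}g$ with $l=\mathrm{lcm}(\mathrm{lm}(f),\mathrm{lm}(g))$. Reduce$(f,G)$: set $h:=f$; while $h\ne0$ and there is a nonzero $g\in G$ with $\mathrm{lm}(g)\mid\mathrm{lm}(h)$, choose such a $g$ and replace $h$ by $h-\frac{\mathrm{lc}(h)\mathrm{lm}(h)}{\mathrm{lc}(g)\mathrm{lm}(g)}g$; return $h$. SigmaGBasis (input: a $\Sigma$-basis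 $H$ of $I$): put $G:=H$, $B:=\{(f,g)\mid f,g\in G\}$. While $B\ne\emptyset$: choose and remove $(f,g)\in B$; for all $i\ge0$ compute $h:=$ Reduce$(\mathrm{spoly}(f,s^i\cdot g),\Sigma\cdot G)$, and if $h\ne0$ put $B:=B\cup\{(h,h),(h,k),(k,h)\mid k\in G\}$ and $G:=G\cup\{h\}$. Return $G$. The $d$-truncated version starts from $H_d$ and considers only those S-polynomials with $\max(\mathrm{w}(f),i+\mathrm{w}(g))\le d$ (and only $i=0$ if $g$ is a constant, since then $s^i\cdot g=g$). *)

(* Defs.v *)
From HB Require Import structures.
From mathcomp Require Import all_boot all_order all_algebra.
From mathcomp Require Import finmap multinomials.monalg.
From mathcomp Require Import boolp classical_sets functions cardinality.

Set Implicit Arguments.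
Unset Strict Implicit.
Unset Printing Implicit Defensive.

Import GRing.Theory.
Local Open Scope classical_set_scope.
Local Open Scope ring_scope.

(* The variable x_i is [<< ucm i >>], where [ucm i] is the i-th monomial
   generator; [<< m >>] embeds a monomial m into the polynomial ring. *)
Notation Mon := {cmonom nat}.
Notation KX K := {malg K[{cmonom nat}]}.

Definition mone1 : Mon := mone.

Definition mgcd (m n : Mon) : Mon :=
  [cmonom minn (m i) (n i) | i in finsupp m]%M.

Definition mlcm (m n : Mon) : Mon :=
  [cmonom maxn (m i) (n i) | i in (finsupp m `|` finsupp n)%fset]%M.

Definition mdivides (m n : Mon) : Prop := exists p : Mon, n = mmul m p.

Record monomial_ordering (lt : rel Mon) : Prop := MonomialOrdering {
  mo_irr : irreflexive lt;
  mo_trans : transitive lt;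
  mo_total : forall m n, m != n -> lt m n || lt n m;
  mo_wf : well_founded (fun m n => lt m n);
  mo_mul : forall p m n, lt m n -> lt (mmul p m) (mmul p n) }.

(* The weights {-oo} u N, with [None] standing for -oo. *)
Definition hatN := option nat.

Definition wmax (a b : hatN) : hatN :=
  match a, b with
  | None, _ => b
  | _, None => a
  | Some m, Some n => Some (maxn m n)
  end.

Definition wshift (i : nat) (a : hatN) : hatN := omap (addn i) a.

Definition wle (a b : hatN) : bool :=
  match a, b with
  | None, _ => true
  | Some _, None => false
  | Some m, Some n => (m <= n)%N
  end.

(* [smon] is the map induced on monomials by the endomorphism sigma. *)
Record weight_function (smon : Mon -> Mon) (w : Mon -> hatN) : Prop :=
  WeightFunction {
  wf_one : w mone1 = None;
  wf_var : forall i, exists k : nat, w (ucm i) = Some k;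
  wf_mul : forall m n, w (mmul m n) = wmax (w m) (w n);
  wf_sigma : forall i, w (smon (ucm i)) = wshift 1 (w (ucm i)) }.

Section Polynomials.
Context {K : fieldType}.
Implicit Types (f g h : KX K) (I G H : set (KX K)).

Definition is_ideal I : Prop :=
  [/\ I 0, forall f g, I f -> I g -> I (f + g)
    & forall p f, I f -> I (p * f)].

Definition ideal_gen (S : set (KX K)) : set (KX K) := smallest is_ideal S.

Section Ordering.
Variable lt : rel Mon.

(* Since 1 is the least monomial, this is the greatest monomial of f when
   f != 0; by convention lm 0 = 1 and lc 0 = 0. *)
Definition lm f : Mon :=
  \big[(fun m n => if lt m n then n else m)/mone1]_(m <- msupp f) m.

Definition lc f : K := f@_(lm f).

Definition spoly f g : KX K :=
  let l := mlcm (lm f) (lm g) in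
  << (lc f)^-1 *g divcm l (lm f) >> * f - << (lc g)^-1 *g divcm l (lm g) >> * g.

Definition red_step (S : set (KX K)) h h' : Prop :=
  h != 0 /\ exists g, [/\ S g, g != 0, mdivides (lm g) (lm h) &
    h' = h - << lc h / lc g *g divcm (lm h) (lm g) >> * g].

Definition irreducible (S : set (KX K)) h : Prop :=
  forall g, S g -> g != 0 -> ~ mdivides (lm g) (lm h).

Definition lm_ideal (S : set (KX K)) : set (KX K) :=
  ideal_gen [set << lm f >> | f in [set f | S f /\ f != 0]].

End Ordering.

Section Weights.
Variable w : Mon -> hatN.

(* The space P_i spanned by the monomials of weight i. *)
Definition wcomp (i : hatN) : set (KX K) :=
  [set f | forall m, m \in msupp f -> w m = i].

Definition whomog f : Prop := f != 0 /\ exists i, wcomp i f.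

(* The weight of a w-homogeneous f is the common weight of its monomials. *)
Definition wdeg f : hatN := \big[wmax/None]_(m <- msupp f) w m.

Definition wgraded I : Prop :=
  forall f, I f -> exists s : seq (KX K),
    (forall g, g \in s -> I g /\ exists i, wcomp i g) /\ f = \sum_(g <- s) g.

Definition wtrunc (d : nat) G : set (KX K) :=
  [set f | G f /\ wle (wdeg f) (Some d)].

End Weights.

Section Sigma.
Variable sigma : {lrmorphism KX K -> KX K}.

Definition sigma_invariant I : Prop := forall f, I f -> I (sigma f).

Definition orbit G : set (KX K) :=
  [set g | exists i : nat, exists2 f, G f & g = iter i sigma f].

Definition sigma_basis I H : Prop :=
  [/\ H `<=` I, ~ H 0 & ideal_gen (orbit H) = I].

Definition groebner_sigma_basis (lt : rel Mon) I G : Prop :=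
  [/\ G `<=` I, ~ G 0 & lm_ideal lt (orbit G) = lm_ideal lt I].

(* The d-truncated SigmaGBasis algorithm. A state (G, B, c) consists of the
   current basis G, the set B of pending S-polynomials, where (f, g, i) stands
   for spoly(f, s^i . g), and the polynomial c = Some h under reduction, or
   None if no reduction is in progress. *)
Section Algorithm.
Variables (lt : rel Mon) (w : Mon -> hatN) (d : nat).

Let index : Type := (KX K * KX K * nat)%type.

Definition state : Type := (set (KX K) * set index * option (KX K))%type.

Definition sweight (t : index) : hatN :=
  wmax (wdeg w t.1.1) (wshift t.2 (wdeg w t.1.2)).

Definition admissible (t : index) : Prop :=
  wle (sweight t) (Some d) /\ ((exists c : K, t.1.2 = c%:MP) -> t.2 = 0%N).

Definition init_spairs G : set index :=
  [set t | [/\ G t.1.1, G t.1.2 & admissible t]].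

Definition new_spairs G h : set index :=
  [set t | admissible t /\
    (t.1 = (h, h) \/ exists2 k, G k & t.1 = (h, k) \/ t.1 = (k, h))].

(* The selection strategy: an S-polynomial of least weight comes first. The
   choices left open (ties, reducers) are nondeterministic. *)
Inductive step : state -> state -> Prop :=
| step_select G B f g i :
    B (f, g, i) ->
    (forall t, B t -> wle (sweight (f, g, i)) (sweight t)) ->
    step (G, B, None) (G, B `\ (f, g, i), Some (spoly lt f (iter i sigma g)))
| step_reduce G B h h' :
    red_step lt (orbit G) h h' ->
    step (G, B, Some h) (G, B, Some h')
| step_discard G B :
    step (G, B, Some 0) (G, B, None)
| step_add G B h :
    h != 0 -> irreducible lt (orbit G) h ->
    step (G, B, Some h) (G `|` [set h], B `|` new_spairs G h, None).

Definition init_state H : state :=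
  let Hd := wtrunc w d H in (Hd, init_spairs Hd, None).

(* Every execution from the given state reaches, after finitely many steps, a
   state with B empty. *)
Inductive stops : state -> Prop :=
| stops_done G : stops (G, set0, None)
| stops_step x :
    (exists y, step x y) -> (forall y, step x y -> stops y) -> stops x.

End Algorithm.
End Sigma.
End Polynomials.

(* Main.v *)
(* Let V be the finite set of the variables occurring in the s^i . f of weight
   <= d, with f in H_d.  Since a variable of sigma(x) may have smaller weight
   than sigma(x), V is filtered by weight: V_k collects the variables of the
   s^i . f of weight <= k, so that s^i sends homogeneous polynomials of weight k
   over V_k to homogeneous polynomials of weight i + k over V_(i+k).
   S-polynomials and reductions respect this filtration, hence the truncated
   algorithm stays in the polynomials over V; each added element has a leading
   monomial that no previous leading monomial divides, and Dickson's lemma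
   bounds the number of additions.

   For the Groebner basis, keep all the homogeneous elements of I of weight > d.
   In weight <= d, write f in I as a polynomial in the variables outside V: the
   generators of weight <= d are over V and the others contribute no monomial of
   weight <= d, so the coefficients of f at monomials of weight <= d lie in I.
   Hence lm f is divisible by the leading monomial of a homogeneous element of I
   over V, and Dickson's lemma again leaves finitely many of these. *)
Require Import Defs.
From HB Require Import structures.
From mathcomp Require Import all_boot all_order all_algebra.
From mathcomp Require Import finmap multinomials.monalg.
From mathcomp Require Import boolp classical_sets functions cardinality.

Set Implicit Arguments.
Unset Strict Implicit.
Unset Printing Implicit Defensive.

Import GRing.Theory.
Local Open Scope classical_set_scope.
Local Open Scope ring_scope.

(** * Divisibility and lcm of monomials *)

Lemma mdividesP (m n : Mon) : mdivides m n <-> forall i, (m i <= n i)%N.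
Proof.
split=> [[p ->] i|le_mn]; first by rewrite cmM leq_addr.
exists (divcm n m); apply/esym/eqP/cmP => i.
by rewrite cmM divcmE subnKC.
Qed.

Lemma mdivides_trans (m n p : Mon) : mdivides m n -> mdivides n p -> mdivides m p.
Proof.
by move=> /mdividesP mn /mdividesP np; apply/mdividesP => i; apply: leq_trans (np i).
Qed.

Lemma mmulI (m : Mon) : injective (mmul m).
Proof.
move=> n p /eqP/cmP E; apply/eqP/cmP => i.
by have := E i; rewrite !cmM => /addnI.
Qed.

Lemma divcmK (m n : Mon) : mdivides m n -> mmul m (divcm n m) = n.
Proof.
by move=> /mdividesP le_mn; apply/eqP/cmP => i; rewrite cmM divcmE subnKC.
Qed.

Lemma mlcmE (m n : Mon) i : mlcm m n i = maxn (m i) (n i).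
Proof.
rewrite cmE fsfun_fun in_fsetU.
by case: (finsuppP m); case: (finsuppP n).
Qed.

Lemma divides_mlcml (m n : Mon) : mdivides m (mlcm m n).
Proof. by apply/mdividesP => i; rewrite mlcmE leq_maxl. Qed.

Lemma divides_mlcmr (m n : Mon) : mdivides n (mlcm m n).
Proof. by apply/mdividesP => i; rewrite mlcmE leq_maxr. Qed.

Lemma mon_ind (P : Mon -> Prop) :
  P mone1 -> (forall i m, P m -> P (mmul (ucm i) m)) -> forall m, P m.
Proof.
move=> P1 PM m; move: {2}(mdeg m) (erefl (mdeg m)) => n.
elim: n m => [|n IHn] m deg_m; first by rewrite (mdeg_eq0I deg_m).
have /fset0Pn[i im] : finsupp m != fset0.
  by apply: contra_eqN deg_m => /eqP m0; rewrite mdegE m0 big_seq_fset0.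
have i_m : mdivides (ucm i) m.
  apply/mdividesP => j; rewrite cmU; case: eqP => // <-.
  by rewrite lt0n cmE_neq0.
rewrite -(divcmK i_m); apply/PM/IHn/eqP.
by rewrite -eqSS -deg_m -{2}(divcmK i_m) mdegM mdegU.
Qed.

(** * Dickson's lemma and its well-founded form *)

Section Dickson.

(** Each index of [phi] minimises [u] over the tail that begins just after the previous index, so
    later values cannot be smaller. *)
Lemma monotone_subsequence (u : nat -> nat) : exists phi : nat -> nat,
  {homo phi : i j / (i < j)%N} /\ {homo (u \o phi) : i j / (i <= j)%N}.
Proof.
have minP N : exists i, (N <= i)%N /\ forall j, (N <= j)%N -> (u i <= u j)%N.
  have ex : exists v, `[< exists2 i, (N <= i)%N & u i = v >].
    by exists (u N); apply/asboolP; exists N.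
  case: (ex_minnP ex) => v /asboolP[i Ni <-] min_v; exists i; split=> // j Nj.
  by apply: min_v; apply/asboolP; exists j.
have [mu muP] := choice minP.
pose phi n := iter n (fun k => mu k.+1) (mu 0).
have phi_lt n : (phi n < phi n.+1)%N by have [] := muP (phi n).+1.
have phi_min n j : (phi n <= j)%N -> (u (phi n) <= u j)%N.
  case: n => [|n] le_j; first by have [_] := muP 0%N; apply.
  have [lt_mu] := muP (phi n).+1; apply.
  exact: leq_trans lt_mu le_j.
exists phi; split; first by apply: homo_ltn => //; exact: ltn_trans.
apply: homo_leq => [//||n]; first exact: leq_trans.
exact/phi_min/ltnW.
Qed.

(** One variable is treated at a time: a further subsequence, monotone at the new variable, stays
    monotone at the earlier ones. *)
Lemma monotone_subsequence_mon (X : seq nat) (u : nat -> Mon) :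
  exists phi : nat -> nat, {homo phi : i j / (i < j)%N} /\
    forall x, x \in X -> {homo (fun n => u (phi n) x) : i j / (i <= j)%N}.
Proof.
elim: X => [|x X [phi [phi_lt phi_le]]]; first by exists id; split=> // ? ?.
have [psi [psi_lt psi_le]] := monotone_subsequence (fun n => u (phi n) x).
have psi_leq : {homo psi : i j / (i <= j)%N} by exact: (ltnW_homo psi_lt).
exists (phi \o psi); split=> [i j ij|y]; first exact/phi_lt/psi_lt.
rewrite inE => /predU1P[->|yX i j ij]; first exact: psi_le.
exact/(phi_le y)/psi_leq.
Qed.

Lemma dickson (X : seq nat) (u : nat -> Mon) :
  (forall n x, x \in finsupp (u n) -> x \in X) ->
  exists i j, (i < j)%N /\ mdivides (u i) (u j).
Proof.
move=> uX; have [phi [phi_lt phi_le]] := monotone_subsequence_mon X u.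
exists (phi 0), (phi 1); split; first exact: phi_lt.
apply/mdividesP => x; case: (mdomP (u (phi 0)) x) => // /uX xX.
exact: phi_le.
Qed.

(** As a well-founded relation this supports induction on the leading monomials found so far,
    without a bound on their number. *)
Definition bad_extension (V : set nat) (L' L : seq Mon) : Prop :=
  exists2 m, L' = m :: L &
    [set` finsupp m] `<=` V /\ forall l, l \in L -> ~ mdivides l m.

(** An inaccessible list has an inaccessible extension; choosing one repeatedly yields an infinite
    sequence of heads, none dividing a later one, against [dickson]. *)
Lemma wf_bad_extension (V : set nat) :
  finite_set V -> well_founded (bad_extension V).
Proof.
move=> /finite_seqP[X VX] L; apply: contrapT => L_nacc.
pose N := {L | ~ Acc (bad_extension V) L}.
have next (s : N) : exists s' : N, bad_extension V (sval s') (sval s).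
  case: s => L' /= nacc; apply: contrapT => no; apply: nacc.
  constructor=> L'' ext; apply: contrapT => nacc''; apply: no.
  by exists (exist _ L'' nacc'').
have [nxt nxtP] := choice next.
pose s n := iter n nxt (exist _ L L_nacc : N).
have sP n : bad_extension V (sval (s n.+1)) (sval (s n)) by exact: nxtP.
pose u n := head mone1 (sval (s n.+1)).
have s_cons n : sval (s n.+1) = u n :: sval (s n).
  by rewrite /u; have [m ->] := sP n.
have u_in i j : (i < j)%N -> u i \in sval (s j).
  elim: j => // j IHj; rewrite ltnS s_cons inE leq_eqVlt.
  by case/predU1P => [->|/IHj ->]; rewrite ?eqxx ?orbT.
have uP n : [set` finsupp (u n)] `<=` V /\
    forall l, l \in sval (s n) -> ~ mdivides l (u n).
  by have [m] := sP n; rewrite s_cons => -[<-].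
have [|i [j [ij div]]] := @dickson X u.
  by move=> n x xu; have := (uP n).1 x xu; rewrite VX.
exact: (uP j).2 (u_in i j ij) div.
Qed.

End Dickson.

(** Induction on the list [L] of leading monomials already represented in a finite subset: an
    uncovered element of [S] gives a bad extension of [L]. *)
Lemma finite_divisors (V : set nat) (T : Type) (lead : T -> Mon) (S : set T) :
  finite_set V -> (forall f, S f -> [set` finsupp (lead f)] `<=` V) ->
  exists F : set T, [/\ finite_set F, F `<=` S
    & forall f, S f -> exists2 g, F g & mdivides (lead g) (lead f)].
Proof.
move=> fV SV.
suff gen (L : seq Mon) : (exists F : set T, [/\ finite_set F, F `<=` S
      & forall l, l \in L -> exists2 f, F f & lead f = l]) ->
  exists F : set T, [/\ finite_set F, F `<=` S
    & forall f, S f -> exists2 g, F g & mdivides (lead g) (lead f)].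
  by apply: (gen [::]); exists set0; split=> //; exact: sub0set.
elim/(well_founded_ind (wf_bad_extension fV)) : L => L IH [F [fF FS FL]].
have [all_div|] := pselect
  (forall f, S f -> exists2 g, F g & mdivides (lead g) (lead f)).
  by exists F.
move=> /existsNP[f /not_implyP[Sf nodiv]].
apply: (IH (lead f :: L)).
  exists (lead f) => //; split; first exact: SV.
  by move=> l /FL[g Fg <-] div; apply: nodiv; exists g.
exists (F `|` [set f]); split.
- by rewrite finite_setU; split.
- by move=> g [/FS|->].
move=> l; rewrite inE => /predU1P[->|/FL[g Fg <-]]; first by exists f => //; right.
by exists g => //; left.
Qed.

(** * Coefficients of monomial multiples *)

Section MonomialMultiples.
Context {K : fieldType}.
Implicit Types (c : K) (f g : KX K) (m n k : Mon).

Lemma msuppUM c m f k :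
  k \in msupp (<< c *g m >> * f) -> exists2 n, n \in msupp f & k = mmul m n.
Proof.
move=> /msuppM_le[k1 [n [/(fsubsetP msuppU_le)]]].
by rewrite in_fset1 => /eqP -> nf ->; exists n.
Qed.

Lemma mcoeffUM c m f n : (<< c *g m >> * f)@_(mmul m n) = c * f@_n.
Proof.
rewrite (mcoeffMlw _ msuppU_le (fsubset_refl _)) big_seq_fset1 mcoeffUU.
have [nf|nf] := boolP (n \in msupp f).
  rewrite (big_fsetD1 n) //= eqxx mulr1n big1_fset ?addr0 // => n'.
  by rewrite in_fsetD1 => /andP[/eqP nn' _] _; case: eqP => // /mmulI.
rewrite (mcoeff_outdom nf) mulr0 big1_fset // => n' n'f _.
by case: eqP => // /mmulI nn'; rewrite -nn' n'f in nf.
Qed.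

Lemma mcoeffUM0 c m f k : ~ mdivides m k -> (<< c *g m >> * f)@_k = 0.
Proof.
move=> m_k; apply/eqP; rewrite mcoeff_eq0; apply/negP => /msuppUM[n _ kE].
by apply: m_k; exists n.
Qed.

Lemma mcoeff_mon m n : (<< m >> : KX K)@_n = (m == n)%:R.
Proof. exact: (mcoeffU m 1 n). Qed.

Lemma malgUE c m : << c *g m >> = c *: << m >> :> KX K.
Proof. by rewrite -mul_malgC malgM_def fgmulUU mul1m mulr1. Qed.

Lemma msupp_neq0 f : f != 0 -> exists m, m \in msupp f.
Proof. by rewrite -msupp_eq0 => /fset0Pn. Qed.

End MonomialMultiples.

(** * Leading monomials and reduction *)

Section LeadingMonomials.
Context {K : fieldType} {lt : rel Mon} (lt_ord : monomial_ordering lt).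
Implicit Types (f g h : KX K) (m n : Mon).

Let le m n := (m == n) || lt m n.

(** If [m] were below 1, repeated multiplication by [m] would descend forever; [nolt] phrases this
    as a well-founded induction on [x]. *)
Lemma mon1_min m : ~~ lt m mone1.
Proof.
apply/negP => lt_m1.
have nolt x : ~ lt (mmul x m) x.
  elim/(well_founded_ind (mo_wf lt_ord)): x => x IH lt_x.
  apply: (IH _ lt_x); have := mo_mul lt_ord m lt_x.
  by rewrite mulmC [mmul m x]mulmC.
by apply: (nolt mone1); rewrite mul1m.
Qed.

Lemma lm_spec f : f != 0 ->
  lm lt f \in msupp f /\
  forall m, m \in msupp f -> m != lm lt f -> lt m (lm lt f).
Proof.
have le_trans : transitive le.
  move=> y x z /predU1P[->//|xy] /predU1P[<-|yz]; first by rewrite /le xy orbT.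
  by rewrite /le (mo_trans lt_ord xy yz) orbT.
have le1 m : le mone1 m.
  rewrite /le; case: eqVneq => //= m1.
  by have := mo_total lt_ord m1; rewrite (negPf (mon1_min m)) orbF.
(* [M] is the fold defining [lm], over an arbitrary list so that induction applies; the default
   [mone1] is harmless because 1 is the least monomial. *)
pose M (s : seq Mon) := \big[(fun m n => if lt m n then n else m)/mone1]_(m <- s) m.
have MP (s : seq Mon) : (s != [::] -> M s \in s) /\ forall m, m \in s -> le m (M s).
  rewrite /M; elim: s => [//|x s [IHin IHle]]; rewrite big_cons; split=> [_|m].
    case: ifP => lt_x; last by rewrite inE eqxx.
    rewrite inE IHin ?orbT //; apply: contraTneq lt_x => ->.
    by rewrite big_nil; apply: mon1_min.
  have xM : le x (if lt x (M s) then M s else x).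
    by rewrite /le; case: ifP => [->|]; rewrite ?eqxx ?orbT.
  rewrite inE => /predU1P[->//|/IHle mM].
  rewrite -/(M s) in mM *; case: ifP => // nlt; apply: (le_trans _ _ _ mM).
  rewrite /le; case: eqVneq => //= Mx.
  by have := mo_total lt_ord Mx; rewrite nlt orbF.
move=> f0; have [Min Mle] := MP (msupp f); split.
  apply: Min; have [m] := msupp_neq0 f0.
  by rewrite -[m \in _]/(m \in enum_fset (msupp f)); case: (enum_fset _).
by move=> m /Mle /predU1P[->|//]; rewrite eqxx.
Qed.

Lemma lm_msupp f : f != 0 -> lm lt f \in msupp f.
Proof. by move=> /lm_spec[]. Qed.

Lemma lm_eq f m : m \in msupp f ->
  (forall n, n \in msupp f -> n != m -> lt n m) -> lm lt f = m.
Proof.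
move=> mf lt_m; have f0 : f != 0.
  by apply: contraTneq mf => ->; rewrite msupp0 in_fset0.
have [lmf lt_lm] := lm_spec f0; apply/eqP; apply: contraT => ne.
have := mo_trans lt_ord (lt_m _ lmf ne) (lt_lm _ mf _).
by rewrite (mo_irr lt_ord) => -> //; rewrite eq_sym.
Qed.

(** The leading terms cancel, and all other monomials of both summands lie strictly below
    [lm lt h]. *)
Lemma red_step_lt S h h' : red_step lt S h h' -> h' != 0 -> lt (lm lt h') (lm lt h).
Proof.
move=> [h0 [g [_ g0 div_gh ->]]]; set q := divcm _ _; set h1 := _ - _ => h10.
have lmE : mmul q (lm lt g) = lm lt h by rewrite mulmC divcmK.
have [_ lt_lmh] := lm_spec h0; have [lmg lt_lmg] := lm_spec g0.
have ne : lm lt h1 != lm lt h.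
  apply: contraTneq (lm_msupp h10) => ->.
  rewrite -mcoeff_eq0 mcoeffB -lmE mcoeffUM lmE divfK ?subrr //.
  by rewrite mcoeff_neq0.
have := fsubsetP (msuppB_le _ _) _ (lm_msupp h10); rewrite in_fsetU.
case/orP=> [/lt_lmh|/msuppUM[n ng lmh1]]; first exact.
rewrite lmh1 -lmE; apply: (mo_mul lt_ord); apply: lt_lmg => //.
by apply: contra_neq ne => n_lm; rewrite lmh1 n_lm.
Qed.

End LeadingMonomials.

(** * Weights of monomials and polynomials *)

Section Weights.

Lemma wle_refl a : wle a a.
Proof. by case: a => //= a. Qed.

Lemma wle_trans b a c : wle a b -> wle b c -> wle a c.
Proof. by case: a b c => [a|] [b|] [c|] //=; apply: leq_trans. Qed.

Lemma wmaxC a b : wmax a b = wmax b a.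
Proof. by case: a b => [a|] [b|] //=; rewrite maxnC. Qed.

Lemma wle_maxl a b : wle a (wmax a b).
Proof. by case: a b => [a|] [b|] //=; rewrite leq_maxl. Qed.

Lemma wle_anti a b : wle a b -> wle b a -> a = b.
Proof.
by case: a b => [a|] [b|] //= ab ba; congr Some; apply/eqP; rewrite eqn_leq ab.
Qed.

Lemma wle_max a b c : wle (wmax a b) c = wle a c && wle b c.
Proof.
case: a b c => [a|] [b|] [c|] //=; rewrite ?andbT //; exact: geq_max.
Qed.

Lemma wmax_idPl a b : wle b a -> wmax a b = a.
Proof. by case: a b => [a|] [b|] //= /maxn_idPl ->. Qed.

Lemma wshift_add i j a : wshift i (wshift j a) = wshift (i + j) a.
Proof. by case: a => //= a; rewrite addnA. Qed.

Lemma wshift_max i a b : wshift i (wmax a b) = wmax (wshift i a) (wshift i b).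
Proof. by case: a b => [a|] [b|] //=; rewrite addn_maxr. Qed.

Lemma wle_shift i a b : wle (wshift i a) (wshift i b) = wle a b.
Proof. by case: a b => [a|] [b|] //=; rewrite leq_add2l. Qed.

Lemma wle_min (T : Type) (B : set T) (v : T -> hatN) :
  B !=set0 -> exists2 t, B t & forall t', B t' -> wle (v t) (v t').
Proof.
(* [code] embeds the weights in the natural numbers, with -oo sent to 0, so that a least one can be
   found there. *)
move=> [t0 Bt0]; pose code a := if a is Some n then n.+1 else 0%N.
have ex : exists n, `[< exists2 t, B t & code (v t) = n >].
  by exists (code (v t0)); apply/asboolP; exists t0.
case: (ex_minnP ex) => n /asboolP[t Bt <-] min_t; exists t => // t' Bt'.
have : (code (v t) <= code (v t'))%N by apply: min_t; apply/asboolP; exists t'.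
by case: (v t) (v t') => [a|] [b|].
Qed.

Lemma wdeg_wcomp (K : fieldType) (w : Mon -> hatN) (k : hatN) (f : KX K) :
  f != 0 -> wcomp w k f -> wdeg w f = k.
Proof.
have const (s : seq Mon) m0 : m0 \in s -> (forall m, m \in s -> w m = k) ->
    \big[wmax/None]_(m <- s) w m = k.
  elim: s m0 => // m s IHs m0 _ wk.
  rewrite big_cons (wk m) ?inE ?eqxx //.
  case: s IHs wk => [|n s] IHs wk; first by rewrite big_nil; case: (k).
  rewrite (IHs n) ?mem_head ?wmax_idPl ?wle_refl // => p ps.
  by apply: wk; rewrite inE ps orbT.
by move=> /msupp_neq0[m0 m0f] wk; apply: (const _ m0).
Qed.

Context {smon : Mon -> Mon} {w : Mon -> hatN} (w_wt : weight_function smon w).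

Lemma w_eq_None m : w m = None -> m = mone1.
Proof.
elim/mon_ind: m => // i m _; rewrite (wf_mul w_wt).
by have [k ->] := wf_var w_wt i; case: (w m).
Qed.

Lemma w_divides m n : mdivides m n -> wle (w m) (w n).
Proof. by move=> [p ->]; rewrite (wf_mul w_wt) wle_maxl. Qed.

Lemma w_var x (m : Mon) : x \in finsupp m -> wle (w (ucm x)) (w m).
Proof.
move=> xm; apply: w_divides; apply/mdividesP => j; rewrite cmU; case: eqP => // <-.
by rewrite lt0n cmE_neq0.
Qed.

End Weights.

(** * The action of sigma on monomials *)

Section Sigma.
Context {K : fieldType} {sigma : {lrmorphism KX K -> KX K}} {smon : Mon -> Mon}.
Hypothesis sigma_mon : forall m : Mon, sigma << m >> = << smon m >>.

Lemma malgU_inj (m n : Mon) : << m >> = << n >> :> KX K -> m = n.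
Proof.
move=> E; have := @mcoeff_mon K m n; rewrite E (mcoeff_mon n n) eqxx => {E}.
by case: eqP => [//|_ /eqP]; rewrite oner_eq0.
Qed.

Lemma smon1 : smon mone1 = mone1.
Proof. by apply: malgU_inj; rewrite -sigma_mon rmorph1. Qed.

Lemma smonM m n : smon (mmul m n) = mmul (smon m) (smon n).
Proof.
have UM (p q : Mon) : << mmul p q >> = << p >> * << q >> :> KX K.
  by rewrite malgM_def fgmulUU mulr1.
by apply: malgU_inj; rewrite UM -!sigma_mon UM rmorphM.
Qed.

Lemma msupp_iter_sigma i f m :
  m \in msupp (iter i sigma f) -> exists2 n, n \in msupp f & m = iter i smon n.
Proof.
elim: i m => [|i IHi] m /=; first by exists m.
set g := iter i sigma f; rewrite {1}(monalgE g) raddf_sum /= => m_in.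
suff [n ng ->] : exists2 n, n \in msupp g & m = smon n.
  by have [n' n'f ->] := IHi n ng; exists n'.
apply: contrapT => no; move: m_in; rewrite -mcoeff_neq0 raddf_sum /=.
rewrite big1_fset ?eqxx // => n ng _; rewrite malgUE linearZ /= sigma_mon mcoeffZ.
rewrite (mcoeff_mon (smon n)); case: eqP => [E|]; rewrite ?mulr0 //.
by case: no; exists n.
Qed.

Lemma iter_smon1 i : iter i smon mone1 = mone1.
Proof. by elim: i => //= i ->; exact: smon1. Qed.

(** Multiplicativity of [smon] reduces the claim to variables, where it is [wf_sigma]; the monomial
    1 keeps weight -oo. *)
Lemma w_smon w : weight_function smon w ->
  forall i m, w (iter i smon m) = wshift i (w m).
Proof.
move=> w_wt; elim=> [|i IHi] m; first by case: (w m).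
rewrite /= -[i.+1]add1n -wshift_add -IHi; elim/mon_ind: {m IHi}(iter i smon m).
  by rewrite smon1 (wf_one w_wt).
by move=> j m IHm; rewrite smonM !(wf_mul w_wt) IHm (wf_sigma w_wt) wshift_max.
Qed.

Lemma finsupp_smon m x : x \in finsupp (smon m) ->
  exists2 y, y \in finsupp m & x \in finsupp (smon (ucm y)).
Proof.
elim/mon_ind: m => [|y m IHm]; first by rewrite smon1 mdom1 in_fset0.
rewrite smonM !mdomD in_fsetU => /orP[xy|/IHm[z zm xz]].
  by exists y => //; rewrite mdomU in_fsetU in_fset1 eqxx.
by exists z => //; rewrite in_fsetU zm orbT.
Qed.

End Sigma.

(** * Homogeneous polynomials over variables filtered by weight *)

Section Truncation.
Context {K : fieldType} {sigma : {lrmorphism KX K -> KX K}} {smon : Mon -> Mon}.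
Hypothesis sigma_inj : injective sigma.
Hypothesis sigma_mon : forall m : Mon, sigma << m >> = << smon m >>.
Context {lt : rel Mon} (lt_ord : monomial_ordering lt).
Context {w : Mon -> hatN} (w_wt : weight_function smon w).
Variables (M : set Mon) (d : nat).
Hypothesis M_fin : finite_set M.
Implicit Types (f g h : KX K) (G : set (KX K)) (m n p q : Mon) (a b k : hatN).

(** This is the set V_k once [M] is taken to be the set of monomials of H_d. *)
Definition hull k : set nat :=
  [set x | exists m i,
    [/\ M m, wle (wshift i (w m)) k & x \in finsupp (iter i smon m)]].

Lemma hull_mono a b : wle a b -> hull a `<=` hull b.
Proof.
move=> ab x [m [i [Mm ia xm]]]; exists m, i; split=> //.
exact: wle_trans ab.
Qed.

Lemma finite_hull : finite_set (hull (Some d)).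
Proof.
pose U := \bigcup_(m in M) \bigcup_(i in `I_d.+1) [set` finsupp (iter i smon m)].
apply: (@sub_finite_set _ _ U) => [x [m [i [Mm le_d xm]]]|].
  exists m => //; exists i => //=; rewrite ltnS.
  case wm: (w m) le_d => [b|] /=; first by apply: leq_trans; rewrite leq_addr.
  (* Weight -oo puts no bound on [i], but then [m] is 1 and its images contain no variable. *)
  by move: xm; rewrite (w_eq_None w_wt wm) (iter_smon1 sigma_mon) mdom1 in_fset0.
apply: bigcup_finite => // m _; apply: bigcup_finite => // i _.
Qed.

(** The bound is [hull k] rather than [hull (Some d)] so that applying [smon] shifts both conditions
    together. *)
Definition lives k m : Prop := w m = k /\ [set` finsupp m] `<=` hull k.

Definition homog k f : Prop := forall m, m \in msupp f -> lives k m.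

Lemma lives_smon k i m : lives k m -> lives (wshift i k) (iter i smon m).
Proof.
elim: i => [|i IHi] kM; first by case: k kM.
have {IHi}[wm mV] := IHi kM; set n := iter i smon m in wm mV.
rewrite -[i.+1]add1n -wshift_add; split.
  by rewrite -[iter _ _ _]/(iter 1 smon n) (w_smon sigma_mon w_wt) wm.
move=> x /= /(finsupp_smon sigma_mon)[y /mV[p [j [Mp jp yp]]] xy].
(* Since [y] occurs in the [j]-th image of [p], the variable [x] of the image of [y] occurs in the
   next one; both sides of the weight bound grow by 1. *)
exists p, j.+1; split=> //; first by rewrite -[j.+1]add1n -wshift_add wle_shift.
have y_p : mdivides (ucm y) (iter j smon p).
  apply/mdividesP => z; rewrite cmU; case: eqP => // <-.
  by rewrite lt0n cmE_neq0.
rewrite iterS -(divcmK y_p) (smonM sigma_mon) mdomD in_fsetU.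
by rewrite xy.
Qed.

Lemma homog_wcomp k f : homog k f -> wcomp w k f.
Proof. by move=> fk m /fk[]. Qed.

Lemma homog_wdeg k f : f != 0 -> homog k f -> wdeg w f = k.
Proof. by move=> f0 /homog_wcomp; apply: wdeg_wcomp. Qed.

Lemma homogB k f g : homog k f -> homog k g -> homog k (f - g).
Proof.
move=> fk gk m /(fsubsetP (msuppB_le _ _)); rewrite in_fsetU => /orP[].
  exact: fk.
exact: gk.
Qed.

Lemma homog_sigma k i f : homog k f -> homog (wshift i k) (iter i sigma f).
Proof.
by move=> fk m /(msupp_iter_sigma sigma_mon)[n /fk nk ->]; apply: lives_smon.
Qed.

(* Since all monomials of [g] have the same weight, one product [q m] of
   weight [k] controls all the products. *)
Lemma homogUM c q m a k g :
  homog a g -> w m = a -> lives k (mmul q m) -> homog k (<< c *g q >> * g).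
Proof.
move=> ga wm [wqm qmV] p /msuppUM[n /ga[wn nV] ->]; split.
  by rewrite (wf_mul w_wt) wn -wm -(wf_mul w_wt).
have ak : wle a k by rewrite -wqm (wf_mul w_wt) wm wmaxC wle_maxl.
move=> x; rewrite /= mdomD in_fsetU => /orP[xq|/nV]; last exact: hull_mono.
by apply: qmV; rewrite /= mdomD in_fsetU xq.
Qed.

(** The lcm divides the product and is a multiple of both factors, which forces its weight to be the
    maximum. *)
Lemma lives_mlcm a b m n : lives a m -> lives b n -> lives (wmax a b) (mlcm m n).
Proof.
move=> [wm mV] [wn nV]; split.
  apply: wle_anti; last first.
    rewrite wle_max -wm -wn (w_divides w_wt (divides_mlcml m n)).
    exact: (w_divides w_wt (divides_mlcmr m n)).
  rewrite -wm -wn -(wf_mul w_wt); apply: (w_divides w_wt); apply/mdividesP => i.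
  by rewrite mlcmE cmM geq_max leq_addr leq_addl.
move=> x /=; rewrite -cmE_neq0 mlcmE -lt0n leq_max !lt0n !cmE_neq0.
case/orP => [/mV|/nV]; apply: hull_mono; first exact: wle_maxl.
by rewrite wmaxC; apply: wle_maxl.
Qed.

Lemma homog_spoly a b f g : f != 0 -> g != 0 -> homog a f -> homog b g ->
  homog (wmax a b) (spoly lt f g).
Proof.
move=> f0 g0 fa gb; have fl := fa _ (lm_msupp lt_ord f0).
have gl := gb _ (lm_msupp lt_ord g0); have l_ab := lives_mlcm fl gl.
apply: homogB.
  apply: homogUM fa fl.1 _; rewrite mulmC divcmK //; exact: divides_mlcml.
apply: homogUM gb gl.1 _; rewrite mulmC divcmK //; exact: divides_mlcmr.
Qed.

(** The multiplier times [lm lt g] is [lm lt h], which lives in weight [k]: this is the single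
    product that [homogUM] asks for. *)
Lemma homog_red_step (S : set (KX K)) k h h' :
  (forall g, S g -> exists a, homog a g) -> homog k h -> red_step lt S h h' ->
  homog k h'.
Proof.
move=> S_hom hk [h0 [g [Sg g0 div ->]]]; have [a ga] := S_hom g Sg.
apply: homogB => //; apply: homogUM ga (ga _ (lm_msupp lt_ord g0)).1 _.
by rewrite mulmC divcmK //; apply/hk/lm_msupp.
Qed.

(** * Termination of the truncated algorithm *)

Definition admissible_basis G : Prop := finite_set G /\
  forall f, G f -> f != 0 /\ exists2 k, wle k (Some d) & homog k f.

Lemma homog_orbit G : admissible_basis G ->
  forall g, Defs.orbit sigma G g -> exists a, homog a g.
Proof.
move=> [_ GP] g [i [f Gf ->]]; have [_ [k _ fk]] := GP f Gf.
by exists (wshift i k); apply: homog_sigma.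
Qed.

Lemma finite_init_spairs G : admissible_basis G -> finite_set (init_spairs w d G).
Proof.
move=> [G_fin GP].
apply: (@sub_finite_set _ _ ((G `*` G) `*` `I_d.+1)); last first.
  by apply: finite_setX => //; apply: finite_setX.
move=> [[f g] i] [/= Gf Gg [le_d const_i]]; split=> //=.
have [g0 [k _ gk]] := GP g Gg; rewrite ltnS.
move: le_d; rewrite /sweight /= (homog_wdeg g0 gk).
case: k gk => [b|] gk /=.
  case: (wdeg w f) => [a|] /=; last exact: leq_trans (leq_addr _ _).
  by rewrite geq_max => /andP[_]; apply: leq_trans; rewrite leq_addr.
(* At weight -oo the weight bound says nothing about [i], but then [g] is constant and admissibility
   forces [i] to be 0. *)
move=> _; have /= -> // := const_i _; exists g@_mone1; apply/malgP => m.
rewrite mcoeffC; case: eqP => [->|ne]; first by rewrite mulr1n.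
by apply: mcoeff_outdom; apply/negP => /gk[/(w_eq_None w_wt)].
Qed.

Lemma iter_sigma_neq0 i f : f != 0 -> iter i sigma f != 0.
Proof.
move=> f0; elim: i => //= i; apply: contra_neq => E.
by apply: sigma_inj; rewrite E raddf0.
Qed.

Lemma homog_select G f g i : admissible_basis G -> init_spairs w d G (f, g, i) ->
  exists2 k, wle k (Some d) & homog k (spoly lt f (iter i sigma g)).
Proof.
move=> [_ GP] [/= /GP[f0 [a _ fa]] /GP[g0 [b _ gb]] [le_d _]].
exists (wmax a (wshift i b)).
  by move: le_d; rewrite /sweight /= (homog_wdeg f0 fa) (homog_wdeg g0 gb).
by apply: homog_spoly => //; [apply: iter_sigma_neq0|apply: homog_sigma].
Qed.

Lemma admissible_basisU G h k : admissible_basis G ->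
  h != 0 -> wle k (Some d) -> homog k h -> admissible_basis (G `|` [set h]).
Proof.
move=> [G_fin GP] h0 kd hk; split; first by rewrite finite_setU; split.
by move=> f [/GP//|->]; split=> //; exists k.
Qed.

Lemma init_spairsU G B h : B `<=` init_spairs w d G ->
  B `|` new_spairs w d G h `<=` init_spairs w d (G `|` [set h]).
Proof.
move=> BG t [/BG[G1 G2 adm]|[adm tP]]; first by split=> //; left.
by case: tP => [tE|[k Gk [tE|tE]]]; split=> //; rewrite tE /=; auto.
Qed.

Lemma step_selectE G B y : step sigma lt w d (G, B, None) y ->
  exists2 t, B t & y = (G, B `\ t, Some (spoly lt t.1.1 (iter t.2 sigma t.1.2))).
Proof.
move E : (G, B, None) => x st.
by case: st E => // G' B' f g i Bt _ [-> ->]; exists (f, g, i).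
Qed.

Lemma step_reduceE G B h y : step sigma lt w d (G, B, Some h) y ->
  [\/ exists2 h', red_step lt (Defs.orbit sigma G) h h' & y = (G, B, Some h'),
      h = 0 /\ y = (G, B, None)
    | [/\ h != 0, irreducible lt (Defs.orbit sigma G) h
        & y = (G `|` [set h], B `|` new_spairs w d G h, None)]].
Proof.
move E : (G, B, Some h) => x st; case: st E => //.
- by move=> G' B' h1 h' red [-> -> ->]; constructor 1; exists h'.
- by move=> G' B' [-> -> ->]; constructor 2.
- by move=> G' B' h' h'0 irr [-> -> ->]; constructor 3.
Qed.

(** Induction on the leading monomial of [h], which drops at each reduction. The last two hypotheses
    are the continuations: remainder 0, or remainder added to [G]. *)
Lemma stops_reduce G B k : admissible_basis G -> stops sigma lt w d (G, B, None) ->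
  (forall h, h != 0 -> homog k h -> irreducible lt (Defs.orbit sigma G) h ->
    stops sigma lt w d (G `|` [set h], B `|` new_spairs w d G h, None)) ->
  forall h, homog k h -> stops sigma lt w d (G, B, Some h).
Proof.
move=> G_adm stop_disc stop_add.
(* Zero is set apart because [lm lt 0] is 1 by convention, so the leading monomial need not drop
   when a reduction ends in 0. *)
have stop0 : stops sigma lt w d (G, B, Some 0).
  apply: stops_step; first by eexists; apply: step_discard.
  by move=> y /step_reduceE[[h' []]|[_ ->]|[]]; rewrite ?eqxx.
move=> h; move: {2}(lm lt h) (erefl (lm lt h)) => m.
elim/(well_founded_ind (mo_wf lt_ord)): m h => m IH h lmh hk.
have [->//|h0] := eqVneq h 0.
apply: stops_step.
  have [irr|] := pselect (irreducible lt (Defs.orbit sigma G) h).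
    by eexists; apply: step_add.
  move=> /existsNP[g /not_implyP[Gg /not_implyP[g0 /contrapT div]]].
  by eexists; apply: step_reduce; split=> //; exists g; split.
move=> y /step_reduceE[[h' red ->]|[h00]|[_ irr ->]].
- have [->//|h'0] := eqVneq h' 0.
  apply: (IH (lm lt h')) => //.
    by rewrite -lmh; apply: red_step_lt red h'0.
  exact: homog_red_step (homog_orbit G_adm) hk red.
- by rewrite h00 eqxx in h0.
- exact: stop_add.
Qed.

(** While [G] is fixed, the number of pending pairs drops at each selection; what follows once [G]
    grows is left to the second hypothesis. *)
Lemma stops_select G : admissible_basis G ->
  (forall B h k, B `<=` init_spairs w d G -> h != 0 -> wle k (Some d) ->
    homog k h -> irreducible lt (Defs.orbit sigma G) h ->
    stops sigma lt w d (G `|` [set h], B `|` new_spairs w d G h, None)) ->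
  forall B, B `<=` init_spairs w d G -> stops sigma lt w d (G, B, None).
Proof.
move=> G_adm stop_add B BG.
have /finite_fsetP[X BX] := sub_finite_set BG (finite_init_spairs G_adm).
have [n le_X] := ubnP #|`X|%fset; elim: n => // n IHn in X B BX BG le_X *.
have [->|/set0P B_neq0] := eqVneq B set0; first exact: stops_done.
apply: stops_step.
  have [[[f g] i] Bt min_t] := wle_min (sweight w) B_neq0.
  by eexists; apply: step_select Bt min_t.
move=> y /step_selectE[[[f g] i] Bt ->] /=.
have B'G : B `\ (f, g, i) `<=` init_spairs w d G by move=> t [/BG].
have [k kd hk] := homog_select G_adm (BG _ Bt).
apply: (stops_reduce (k := k)) => //; last first.
  by move=> h h0 h_k irr; apply: stop_add h_k irr.
apply: (IHn (X `\ (f, g, i))%fset) => //.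
  by rewrite BX set_fsetD1.
move: le_X; rewrite (cardfsD1 (f, g, i)).
by have -> : (f, g, i) \in X by move: Bt; rewrite BX.
Qed.

(** Outer induction along [bad_extension], on a list [L] of leading monomials of [G]: no entry of
    [L] divides the leading monomial of an irreducible remainder. The list decides, so the number of
    new pairs does not matter. *)
Lemma stops_admissible G B : admissible_basis G -> B `<=` init_spairs w d G ->
  stops sigma lt w d (G, B, None).
Proof.
suff gen (L : seq Mon) : forall G B, admissible_basis G ->
    B `<=` init_spairs w d G -> (forall l, l \in L -> exists2 g, G g & lm lt g = l) ->
    stops sigma lt w d (G, B, None).
  by move=> G_adm BG; apply: (gen [::]).
elim/(well_founded_ind (wf_bad_extension finite_hull)): L => L IH {}G {}B G_adm BG GL.
apply: stops_select => // {BG}B h k BG h0 kd hk irr.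
apply: (IH (lm lt h :: L)).
- exists (lm lt h) => //; split.
    have [_ hV] := hk _ (lm_msupp lt_ord h0).
    by apply: subset_trans hV _; apply: hull_mono.
  move=> l /GL[g Gg <-]; apply: irr; last by have [] := G_adm.2 g Gg.
  by exists 0%N, g.
- exact: admissible_basisU hk.
- exact: init_spairsU.
move=> l; rewrite inE => /predU1P[->|/GL[g Gg <-]]; first by exists h => //; right.
by exists g => //; left.
Qed.

End Truncation.

(** * Generated ideals *)

Section IdealGenerated.
Context {K : fieldType}.
Implicit Types (S T I : set (KX K)).

Lemma is_ideal_gen S : is_ideal (ideal_gen S).
Proof.
split=> [T [[]]//|f g Sf Sg T TP|p f Sf T TP]; have [[T0 TD TM] ST] := TP.
  by apply: TD; [apply: Sf|apply: Sg].
by apply: TM; apply: Sf.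
Qed.

Lemma ideal_gen_min S I : is_ideal I -> S `<=` I -> ideal_gen S `<=` I.
Proof. by move=> I_ideal SI f; apply. Qed.

Lemma sub_ideal_gen S : S `<=` ideal_gen S.
Proof. by move=> f Sf T [_]; apply. Qed.

End IdealGenerated.

(** * Coefficients with respect to the variables outside V *)

Definition off (V : set nat) (m : Mon) : Prop := forall x, V x -> m x = 0%N.

Definition within (V : set nat) (m : Mon) : Prop := [set` finsupp m] `<=` V.

Lemma within0 (V : set nat) m x : within V m -> ~ V x -> m x = 0%N.
Proof. by move=> mV nVx; case: (mdomP m x) => // /mV. Qed.

Lemma withinM V m n : within V (mmul m n) <-> within V m /\ within V n.
Proof.
rewrite /within mdomD; split=> [mnV|[mV nV] x /=].
  by split=> x /= xm; apply: mnV; rewrite /= in_fsetU xm ?orbT.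
by rewrite in_fsetU => /orP[/mV|/nV].
Qed.

Lemma split_mon V m : exists u v, [/\ m = mmul u v, off V u & within V v].
Proof.
elim/mon_ind: m => [|x m [u [v [-> uV vV]]]].
  exists mone1, mone1; split; first by rewrite mul1m.
    by move=> x _; rewrite cm1.
  by move=> x; rewrite /= mdom1 in_fset0.
have [Vx|nVx] := pselect (V x).
  exists u, (mmul (ucm x) v); split=> //; first by rewrite !mulmA [mmul _ u]mulmC.
  by apply/withinM; split=> // y; rewrite /= mdomU in_fset1 => /eqP ->.
exists (mmul (ucm x) u), v; split=> //; first by rewrite mulmA.
by move=> y Vy; rewrite cmM uV // cmU addn0; case: eqP => // xy; rewrite xy in nVx.
Qed.

(** Exponents can be compared separately outside [V], where only [u] and [t] count, and inside [V],
    where only [v] and [m] count. *)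
Lemma divides_split V u v t m : off V u -> within V v -> off V t -> within V m ->
  mdivides (mmul u v) (mmul t m) -> mdivides u t /\ mdivides v m.
Proof.
move=> uV vV tV mV /mdividesP uv_tm; split; apply/mdividesP => x; have := uv_tm x.
  rewrite !cmM; have [Vx|nVx] := pselect (V x); first by rewrite uV.
  by rewrite (within0 vV) // (within0 mV) // !addn0.
rewrite !cmM; have [Vx|nVx] := pselect (V x); first by rewrite uV // tV.
by rewrite (within0 vV).
Qed.

Section Coefficients.
Context {K : fieldType} (V : set nat).
Implicit Types (f g h p : KX K) (S I : set (KX K)).

Definition supported f : Prop := forall m, m \in msupp f -> within V m.

(* [g] is the coefficient of [t] in [f], for [f] seen as a polynomial in the
   variables outside [V] over the polynomials in the variables of [V]. *)
Definition coefficient (t : Mon) f g : Prop :=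
  supported g /\ forall m, within V m -> g@_m = f@_(mmul t m).

Lemma coefficient0 t f :
  (forall m, within V m -> f@_(mmul t m) = 0) -> coefficient t f 0.
Proof.
move=> f0; split=> [m|m mV]; first by rewrite msupp0 in_fset0.
by rewrite mcoeff0 f0.
Qed.

Lemma coefficientD t f f' g g' :
  coefficient t f g -> coefficient t f' g' -> coefficient t (f + f') (g + g').
Proof.
move=> [gV gE] [g'V g'E]; split=> [m|m mV].
  by move/(fsubsetP (msuppD_le _ _)); rewrite in_fsetU => /orP[/gV|/g'V].
by rewrite !mcoeffD gE // g'E.
Qed.

Lemma coefficientUM t u v c f g : off V u -> within V v -> off V (mmul u t) ->
  coefficient t f g ->
  coefficient (mmul u t) (<< c *g mmul u v >> * f) (<< c *g v >> * g).
Proof.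
move=> uV vV tV [gV gE]; split=> [m /msuppUM[n /gV nV ->]|m mV].
  exact/withinM.
have [[n mE]|v_m] := pselect (mdivides v m).
  rewrite mE mcoeffUM gE; last by move: mV; rewrite mE => /withinM[].
  suff -> : mmul (mmul u t) (mmul v n) = mmul (mmul u v) (mmul t n).
    by rewrite mcoeffUM.
  by rewrite -!mulmA; congr mmul; rewrite !mulmA [mmul t v]mulmC.
rewrite !mcoeffUM0 // => /(divides_split uV vV tV mV)[_ div_v].
exact: v_m.
Qed.

(** The polynomials whose coefficients at all [t] in [Q] off [V] lie in [I] form an ideal. Closure
    of [Q] under divisors enters because the coefficient at [u s'] of a multiple by [u v] comes from
    the coefficient at [s']. *)
Lemma coefficient_ideal (Q : set Mon) S I :
  (forall m n, mdivides m n -> Q n -> Q m) -> is_ideal I ->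
  (forall f t, S f -> off V t -> Q t -> exists2 g, I g & coefficient t f g) ->
  forall f t, ideal_gen S f -> off V t -> Q t -> exists2 g, I g & coefficient t f g.
Proof.
move=> Q_div [I0 ID IM] SP f t Sf tV Qt.
pose J := [set f | forall t, off V t -> Q t -> exists2 g, I g & coefficient t f g].
suff J_ideal : is_ideal J.
  by apply: (ideal_gen_min J_ideal _ Sf) => // g Sg u; apply: SP.
have JD h h' : J h -> J h' -> J (h + h').
  move=> Jh Jh' u uV Qu; have [g Ig gE] := Jh u uV Qu.
  have [g' Ig' g'E] := Jh' u uV Qu.
  by exists (g + g'); [apply: ID|apply: coefficientD].
have J0 : J 0.
  by move=> u _ _; exists 0 => //; apply: coefficient0 => m _; rewrite mcoeff0.
split=> // p h Jh; rewrite (monalgE p) mulr_suml.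
elim/big_rec: _ => // m q _ Jq; apply: (JD _ _ _ Jq) => {q Jq} s sV Qs.
have [u [v [-> uV vV]]] := split_mon V m.
have [[s' sE]|u_s] := pselect (mdivides u s).
  have s'V : off V s'.
    by move=> x Vx; have /eqP := sV x Vx; rewrite sE cmM addn_eq0 => /andP[_ /eqP].
  have [|g Ig gE] := Jh s' s'V.
    by apply: Q_div Qs; exists u; rewrite sE mulmC.
  exists (<< p@_(mmul u v) *g v >> * g); first exact: IM.
  by rewrite sE; apply: coefficientUM => //; rewrite -sE.
(* If [u] does not divide [s], the multiple has no monomial whose part outside [V] is [s]. *)
exists 0 => //; apply: coefficient0 => n nV.
by rewrite mcoeffUM0 // => /(divides_split uV vV sV nV)[].
Qed.

Context {lt : rel Mon} (lt_ord : monomial_ordering lt).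

(** Monomials of [g] times [t] are monomials of [f], and multiplication by [t] reflects the ordering
    because it is total. *)
Lemma lm_coefficient t v f g : f != 0 -> lm lt f = mmul t v -> within V v ->
  coefficient t f g -> g != 0 /\ lm lt g = v.
Proof.
move=> f0 lmf vV [gV gE]; have [lm_f lt_lm] := lm_spec lt_ord f0.
have vg : v \in msupp g by rewrite -mcoeff_neq0 gE // -lmf mcoeff_neq0.
split; first by apply: contraTneq vg => ->; rewrite msupp0 in_fset0.
apply: (lm_eq lt_ord vg) => n ng nv.
have tn : lt (mmul t n) (mmul t v).
  rewrite -lmf; apply: lt_lm; last by rewrite lmf; apply: contra_neq nv => /mmulI.
  by rewrite -mcoeff_neq0 -gE ?mcoeff_neq0 //; apply: gV.
case/orP: (mo_total lt_ord nv) => // /(mo_mul lt_ord t) tv.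
by have := mo_trans lt_ord tn tv; rewrite (mo_irr lt_ord).
Qed.

Lemma lm_subset f g m : f != 0 -> lm lt f = m -> m \in msupp g ->
  (forall n, n \in msupp g -> n \in msupp f) -> lm lt g = m.
Proof.
move=> f0 <- mg gf; apply: (lm_eq lt_ord mg) => n /gf nf.
by have [_] := lm_spec lt_ord f0; apply.
Qed.

End Coefficients.

(** * Homogeneous components in graded ideals *)

Section GradedIdeals.
Context {K : fieldType} {lt : rel Mon} (lt_ord : monomial_ordering lt).
Context {w : Mon -> hatN}.
Implicit Types (f g h : KX K).
Variable I : set (KX K).
Hypotheses (I_ideal : is_ideal I) (I_graded : wgraded w I).

(** The list given by [wgraded] may contain several elements of one weight; the component is the sum
    of those of weight [k]. *)
Lemma graded_component k f : I f ->
  exists2 g, I g & forall m, g@_m = if w m == k then f@_m else 0.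
Proof.
move=> /I_graded[s [sI ->]]; have [I0 ID _] := I_ideal.
elim: s sI => [|h s IHs] sI.
  by exists 0 => // m; rewrite big_nil mcoeff0 if_same.
have [h' h's|g Ig gE] := IHs; first by apply: sI; rewrite inE h's orbT.
have [Ih [j hj]] := sI h (mem_head _ _).
have h_off m : w m != j -> h@_m = 0.
  by move=> wm; apply: mcoeff_outdom; apply: contra_neqN wm => /hj.
have [jk|jk] := eqVneq j k.
  exists (h + g); first exact: ID.
  move=> m; rewrite big_cons !mcoeffD gE; case: eqVneq => // wm.
  by rewrite h_off ?addr0 // jk.
exists g => // m; rewrite gE big_cons mcoeffD; case: eqVneq => // wm.
by rewrite h_off ?add0r // wm eq_sym.
Qed.

(** The component in the weight of [lm lt f] keeps that monomial, so leading monomials of [I] can be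
    sought among homogeneous elements. *)
Lemma graded_component_lm f : I f -> f != 0 -> exists g,
  [/\ I g, g != 0, lm lt g = lm lt f, wcomp w (w (lm lt f)) g
    & forall m, m \in msupp g -> m \in msupp f].
Proof.
move=> If f0; have [g Ig gE] := graded_component (w (lm lt f)) If.
have gf m : m \in msupp g -> m \in msupp f.
  by rewrite -!mcoeff_neq0 gE; case: ifP; rewrite ?eqxx.
have lmg : lm lt f \in msupp g.
  by rewrite -mcoeff_neq0 gE eqxx mcoeff_neq0 lm_msupp.
exists g; split=> //.
- by apply: contraTneq lmg => ->; rewrite msupp0 in_fset0.
- exact: (lm_subset lt_ord f0).
by move=> m; rewrite -mcoeff_neq0 gE; case: (w m =P _) => // _; rewrite eqxx.
Qed.

End GradedIdeals.

(** * Comparison of leading monomial ideals *)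

Section LmIdeals.
Context {K : fieldType} (lt : rel Mon).
Implicit Types (S T : set (KX K)).

Lemma lm_idealS S T : S `<=` T -> lm_ideal lt S `<=` lm_ideal lt T.
Proof.
move=> ST; apply: ideal_gen_min; first exact: is_ideal_gen.
move=> _ [f [/ST Tf f0] <-]; apply: sub_ideal_gen.
by exists f.
Qed.

Lemma lm_ideal_divides S T :
  (forall f, T f -> f != 0 -> exists g,
    [/\ S g, g != 0 & mdivides (lm lt g) (lm lt f)]) ->
  lm_ideal lt T `<=` lm_ideal lt S.
Proof.
move=> ST; apply: ideal_gen_min; first exact: is_ideal_gen.
move=> _ [f [Tf f0] <-]; have [g [Sg g0 [q ->]]] := ST f Tf f0.
rewrite /lm_ideal; set T' := (X in ideal_gen X).
have -> : << mmul (lm lt g) q >> = << q >> * << lm lt g >> :> KX K.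
  by rewrite malgM_def fgmulUU mulr1 mulmC.
have [_ _] := is_ideal_gen T'; apply; apply: sub_ideal_gen.
by exists g.
Qed.

End LmIdeals.

(** * Groebner bases up to weight d, and the theorem *)

Lemma groebner_truncation (K : fieldType) (lt : rel Mon) (smon : Mon -> Mon)
    (w : Mon -> hatN) (I S : set (KX K)) (V : set nat) (d : nat) :
  monomial_ordering lt -> weight_function smon w ->
  is_ideal I -> wgraded w I -> ideal_gen S = I ->
  finite_set V -> (forall x, V x -> wle (w (ucm x)) (Some d)) ->
  (forall f, S f -> exists2 k, wcomp w k f & wle k (Some d) -> supported V f) ->
  exists F : set (KX K), [/\ finite_set F, F `<=` I,
      forall f, F f -> f != 0 /\ exists2 k, wle k (Some d) & wcomp w k f
    & forall f, I f -> f != 0 -> wle (w (lm lt f)) (Some d) ->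
        exists2 g, F g & mdivides (lm lt g) (lm lt f)].
Proof.
move=> lt_ord w_wt I_ideal I_graded SI V_fin Vd SV.
pose C := [set f : KX K | [/\ I f, f != 0, supported V f
  & exists2 k, wle k (Some d) & wcomp w k f]].
have CV f : C f -> [set` finsupp (lm lt f)] `<=` V.
  by move=> [_ f0 fV _]; apply: fV; apply: lm_msupp.
have [F [F_fin FC FP]] := finite_divisors V_fin CV.
exists F; split=> //; [by move=> f /FC[] | by move=> f /FC[] |].
have w_within m : within V m -> wle (w m) (Some d).
  elim/mon_ind: m => [|x m IHm]; first by rewrite (wf_one w_wt).
  move=> /withinM[xV /IHm]; rewrite (wf_mul w_wt) wle_max => ->; rewrite andbT.
  by apply/Vd/xV; rewrite /= mdomU in_fset1 eqxx.
move=> f If f0 lm_d; have [t [v [lmE tV vV]]] := split_mon V (lm lt f).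
(* As a divisor of [lm lt f], [t] has weight at most d; at such [t], generators of weight above d
   contribute nothing. *)
pose Q (m : Mon) : Prop := wle (w m) (Some d).
have Q_div m n : mdivides m n -> Q n -> Q m.
  by move=> /(w_divides w_wt); apply: wle_trans.
have Qt : Q t by apply: Q_div lm_d; exists v.
have [||g Ig gE] := @coefficient_ideal K V Q S I Q_div I_ideal _ f t _ tV Qt.
- move=> h u /[dup] Sh /SV[k hk hV] uV Qu.
  have Ih : I h by rewrite -SI; apply: sub_ideal_gen.
  have [I0 _ _] := I_ideal.
  have [kd|kd] := boolP (wle k (Some d)); last first.
    (* Both [u] and [m] have weight at most d, so their product cannot occur in [h], whose weight
       exceeds d. *)
    exists 0 => //; apply: coefficient0 => m mV; apply: mcoeff_outdom.
    apply: contraNN kd => /hk <-; rewrite (wf_mul w_wt) wle_max.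
    by rewrite (w_within m mV) andbT.
  (* A generator over [V] is its own coefficient at 1 and has coefficient 0 at every other monomial
     off [V]. *)
  have [->|u1] := eqVneq u mone1.
    by exists h => //; split=> [|m _]; [apply: hV|rewrite mul1m].
  exists 0 => //; apply: coefficient0 => m mV; apply: mcoeff_outdom.
  apply: contra_neqN u1 => /(hV kd)/withinM[uV' _].
  apply/eqP/cmP => x; rewrite cm1.
  by have [/uV|/(within0 uV')] := pselect (V x).
- by rewrite SI.
have [g0 lmg] := lm_coefficient lt_ord f0 lmE vV gE.
(* The coefficient [g] need not be homogeneous; its component in the weight of its leading monomial
   is, and belongs to [C]. *)
have [h [Ih h0 lmh hw hg]] := graded_component_lm lt_ord I_ideal I_graded Ig g0.
have [|e Fe div_e] := FP h; last first.
  exists e => //; apply: mdivides_trans div_e _.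
  by rewrite lmh lmg lmE; exists t; rewrite mulmC.
split=> //; first by move=> m /hg; apply: gE.1.
by exists (w (lm lt g)) => //; rewrite lmg w_within.
Qed.

Theorem proposition5p20 (K : fieldType)
    (sigma : {lrmorphism KX K -> KX K}) (smon : Mon -> Mon)
    (sigma_inj : injective sigma)
    (sigma_inf : forall n : nat, (0 < n)%N -> exists f, iter n sigma f <> f)
    (sigma_mon : forall m : Mon, sigma << m >> = << smon m >>)
    (sigma_gcd : forall i j : nat, i <> j ->
       mgcd (smon (ucm i)) (smon (ucm j)) = mone1)
    (lt : rel Mon) (lt_ord : monomial_ordering lt)
    (lt_sigma : forall m n : Mon, lt m n -> lt (smon m) (smon n))
    (w : Mon -> hatN) (w_weight : weight_function smon w)
    (I : set (KX K)) (I_ideal : is_ideal I)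
    (I_graded : wgraded w I) (I_sigma : sigma_invariant sigma I)
    (d : nat)
    (H : set (KX K)) (H_basis : sigma_basis sigma I H)
    (H_homog : forall f, H f -> whomog w f)
    (Hd_fin : finite_set (wtrunc w d H)) :
  (exists G : set (KX K),
     [/\ groebner_sigma_basis sigma lt I G,
         forall f, G f -> whomog w f
       & finite_set (wtrunc w d G)]) /\
  stops sigma lt w d (init_state w d H).
Proof.
have [HI H0 HgenI] := H_basis.
pose M := [set m : Mon | exists2 f, wtrunc w d H f & m \in msupp f].
have M_fin : finite_set M.
  have -> : M = \bigcup_(f in wtrunc w d H) [set` msupp f].
    by apply/seteqP; split=> m [f Hf mf]; exists f.
  apply: bigcup_finite => // f _. exact: (@finite_fset Mon (msupp f)).
have Hd_homog f : wtrunc w d H f -> f != 0 /\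
    exists2 k, wle k (Some d) & homog (smon := smon) (w := w) M k f.
  move=> Hdf; have [Hf f_d] := Hdf; have [f0 [k fk]] := H_homog f Hf.
  split=> //; exists k; first by rewrite -(wdeg_wcomp f0 fk).
  move=> m mf; split; first exact: fk.
  move=> x xm; exists m, 0%N; split=> //; first by exists f.
  by rewrite (fk m mf); case: (k) => //= a; rewrite add0n.
split; last first.
  by apply: (stops_admissible sigma_inj sigma_mon lt_ord w_weight M_fin) => //.
pose V := hull (smon := smon) (w := w) M (Some d).
have Vd x : V x -> wle (w (ucm x)) (Some d).
  move=> [m [i [_ md xm]]]; apply: wle_trans (w_var w_weight xm) _.
  by rewrite (w_smon sigma_mon w_weight).
(* Sigma never lowers weights, so an orbit element of weight at most d comes from an element of
   H_d. *)
have SV f : Defs.orbit sigma H f ->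
    exists2 k, wcomp w k f & wle k (Some d) -> supported V f.
  move=> [i [h Hh ->]]; have [h0 [k hk]] := H_homog h Hh.
  exists (wshift i k).
    move=> m /(msupp_iter_sigma sigma_mon)[n nh ->].
    by rewrite (w_smon sigma_mon w_weight) (hk n nh).
  move=> kd m /(msupp_iter_sigma sigma_mon)[n nh ->] x xm.
  exists n, i; split=> //; last by rewrite (hk n nh).
  exists h => //; split=> //; rewrite (wdeg_wcomp h0 hk).
  by case: (k) kd => //= a; apply: leq_trans; rewrite leq_addl.
have [F [F_fin FI F_homog FP]] := groebner_truncation lt_ord w_weight I_ideal I_graded
  HgenI (finite_hull sigma_mon w_weight d M_fin) Vd SV.
(* Taking all homogeneous elements of [I] of weight above d settles the leading monomials of such
   weight and adds nothing to the truncation at d. *)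
pose L := [set f : KX K | [/\ I f, f != 0 &
  exists2 k, ~~ wle k (Some d) & wcomp w k f]].
have G_homog f : (F `|` L) f -> whomog w f.
  by case=> [/F_homog[f0 [k _ fk]]|[_ f0 [k _ fk]]]; split=> //; exists k.
have GI : F `|` L `<=` I by move=> f [/FI|[]].
exists (F `|` L); split=> //; last first.
  apply: sub_finite_set F_fin => f [[//|[_ f0 [k kd fk]]]].
  by rewrite (wdeg_wcomp f0 fk) (negPf kd).
split=> //; first by move=> /G_homog[]; rewrite eqxx.
apply/seteqP; split.
  apply: lm_idealS => _ [i [f /GI If ->]].
  by elim: i => //= i; apply: I_sigma.
apply: lm_ideal_divides => f If f0.
have orbG g : (F `|` L) g -> Defs.orbit sigma (F `|` L) g by exists 0%N, g.
have [lm_d|lm_d] := boolP (wle (w (lm lt f)) (Some d)).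
  have [g Fg div] := FP f If f0 lm_d.
  exists g; split=> //; first by apply: orbG; left.
  by have [] := F_homog g Fg.
have [g [Ig g0 lmg gw _]] := graded_component_lm lt_ord I_ideal I_graded If f0.
exists g; split=> //; last by rewrite lmg; apply/mdividesP.
by apply: orbG; right; split=> //; exists (w (lm lt f)).
Qed.
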